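(* Let $g(x)\in\mathbb F_q[x]$ be a good exceptional polynomial over $\mathbb F_q$. Then $g(x)$ is not decomposable.
   Context: Let $q$ be a power of a prime. A polynomial $f\in\mathbb F_q[x]$ is exceptional over $\mathbb F_q$ if it is a permutation polynomial of $\mathbb F_{q^s}$ (induces a bijection of $\mathbb F_{q^s}$) for infinitely many $s$. An exceptional polynomial $g\in\mathbb F_q[x]$ with $g(0)=0$ and $g'(0)\neq0$ is called good if the roots of $\frac{g(-x)}{-x}$ in $\overline{\mathbb F}_q$ form a unique orbit under the Frobenius map $x\mapsto x^q$ (roots are considered as a set, without multiplicities). An exceptional polynomial $g$ is decomposable if there exist exceptional polynomials $g_1,g_2$ over $\mathbb F_q$ of degree greater than $1$ such that $g(x)=g_1(g_2(x))$. *)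

(* Defs.v *)
From mathcomp Require Import all_boot all_order all_algebra all_field.

Set Implicit Arguments.
Unset Strict Implicit.
Unset Printing Implicit Defensive.

Import GRing.Theory.
Local Open Scope ring_scope.

(* q is #|F|. The degree-s extension of F is unique up to F-isomorphism, so it
   does not matter which model L of F_(q^s) is used. *)
Definition permutes_ext (F : finFieldType) (f : {poly F}) (s : nat) : Prop :=
  exists2 L : fieldExtType F,
    \dim {:L} = s & bijective (fun x : L => (map_poly (in_alg L) f).[x]).

Definition exceptional (F : finFieldType) (f : {poly F}) : Prop :=
  forall N : nat, exists2 s : nat, (N < s)%N & permutes_ext f s.

(* The Frobenius map permutes the algebraic closure and acts with finite order
   on each element, so the orbit of x consists of its forward iterates. *)
Definition in_frobenius_orbit (q : nat) (K : closedFieldType) (x y : K) : Prop :=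
  exists n : nat, y = iter n (fun z : K => z ^+ q) x.

(* g(-x) / (-x); the division is exact when g(0) = 0. *)
Definition reflected_quotient (F : finFieldType) (g : {poly F}) : {poly F} :=
  (g \Po (- 'X)) %/ (- 'X).

(* An orbit is nonempty, so reflected_quotient g is required to have a root. *)
Definition good (F : finFieldType) (K : closedFieldType)
    (iota : {rmorphism F -> K}) (g : {poly F}) : Prop :=
  [/\ exceptional g, g.[0] = 0, g^`().[0] != 0 &
    exists x : K, forall y : K,
      root (map_poly iota (reflected_quotient g)) y
        <-> in_frobenius_orbit #|F| x y].

Definition decomposable (F : finFieldType) (g : {poly F}) : Prop :=
  exists g1 g2 : {poly F},
    [/\ exceptional g1, exceptional g2,
        (1 < (size g1).-1)%N, (1 < (size g2).-1)%N & g = g1 \Po g2].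

(* Main.v *)
(* In the notation g = g1 o g2 with c = g2(0): since g'(0) <> 0, the fibre of g2
   over c contains some a <> 0, and g1 has a root b <> c, which lifts to d with
   g2(d) = b.  Both a and d are nonzero roots of g, hence lie in one Frobenius
   orbit.  But g2 commutes with Frobenius and c is fixed by it, so the
   points of that orbit are all mapped to c by g2, or none is. *)
Require Import Defs.
From mathcomp Require Import all_boot all_order all_algebra all_field.

Set Implicit Arguments.
Unset Strict Implicit.
Unset Printing Implicit Defensive.

Import GRing.Theory.
Local Open Scope ring_scope.

Lemma simple_root_not_unique (K : closedFieldType) (p : {poly K}) (u : K) :
  (2 < size p)%N -> root p u -> p^`().[u] != 0 ->
  exists2 v, v != u & root p v.
Proof.
move=> sp /factor_theorem[r pE].
rewrite pE derivM derivXsubC !hornerE subrr mulr0 add0r => ru.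
have r0 : r != 0 by apply: contraNneq ru => ->; rewrite horner0.
have sr : size r != 1.
  move: sp; rewrite pE size_Mmonic ?monicXsubC // size_XsubC addn2.
  by case: (size r) => [|[]].
have /closed_rootP[v rv] := sr.
exists v; last by rewrite rootM rv.
by apply: contraNneq ru => <-.
Qed.

Section Frobenius.

Variables (F : finFieldType) (K : closedFieldType) (iota : {rmorphism F -> K}).

Local Notation frob := (fun z : K => z ^+ #|F|).

Lemma frobeniusD (x y : K) : (x + y) ^+ #|F| = x ^+ #|F| + y ^+ #|F|.
Proof.
have [p p_pr pF] := finPcharP F.
have pK : p \in [pchar K] by rewrite (fmorph_pchar iota).
rewrite exprDn_pchar // (card_primeChar pF) (eq_pnat _ (pcharf_eq pK)).
by rewrite pnatX pnat_id.
Qed.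

(** The map [frob] is additive and multiplicative on [K] and fixes the coefficients, which come from
    [F]. *)
Lemma horner_iter_frobenius (p : {poly F}) n (z : K) :
  (map_poly iota p).[iter n frob z] = iter n frob (map_poly iota p).[z].
Proof.
elim: n => //= n <-; move: (iter n frob z) => {}z.
elim/poly_ind: p => [|p c IHp].
  by rewrite rmorph0 !horner0 expr0n (cardD1 0) inE.
rewrite rmorphD rmorphM /= map_polyX map_polyC !hornerE IHp frobeniusD exprMn.
by rewrite -rmorphXn expf_card.
Qed.

Lemma iter_frobenius_inj n : injective (iter n frob).
Proof.
elim: n => //= n IHn x y /eqP; rewrite -subr_eq0 => /eqP E.
apply: IHn; apply/eqP; rewrite -subr_eq0.
move: E; set u := iter n _ x; set v := iter n _ y => E.
have: (u - v) ^+ #|F| == 0.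
  (* Additivity is applied to [(u - v) + v], so the power of [- v] never has to be computed. *)
  rewrite -(addrK (v ^+ #|F|) ((u - v) ^+ #|F|)) -frobeniusD subrK.
  exact/eqP.
by rewrite expf_eq0 => /andP[].
Qed.

Lemma iter_frobenius_fixed n (c : F) : iter n frob (iota c) = iota c.
Proof. by elim: n => //= n ->; rewrite -rmorphXn expf_card. Qed.

Lemma fibre_frobenius_orbit (p : {poly F}) (c : F) (x y : K) :
  in_frobenius_orbit #|F| x y ->
  (map_poly iota p).[y] = iota c <-> (map_poly iota p).[x] = iota c.
Proof.
move=> [n ->]; rewrite horner_iter_frobenius; split=> [|->].
  by rewrite -{1}(iter_frobenius_fixed n c) => /iter_frobenius_inj.
exact: iter_frobenius_fixed.
Qed.

(** Evaluating the exact division of [g \Po - 'X] by [- 'X] at [- y] leaves the cofactor [y], which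
    can be cancelled. *)
Lemma root_reflected_quotient (g : {poly F}) (y : K) :
  g.[0] = 0 -> y != 0 -> root (map_poly iota g) y ->
  root (map_poly iota (reflected_quotient g)) (- y).
Proof.
move=> g0 y0 gy.
have X_dvd : - 'X %| g \Po (- 'X).
  have -> : - 'X = - 1 *: ('X - 0%:P) :> {poly F} by rewrite scaleN1r subr0.
  rewrite dvdpZl ?oppr_eq0 ?oner_eq0 // dvdp_XsubCl rootE.
  by rewrite horner_comp !hornerE oppr0 mulr0 g0.
have := gy; rewrite rootE -{1}[y]opprK.
have -> : (map_poly iota g).[- - y] = (map_poly iota (g \Po - 'X)).[- y].
  by rewrite map_comp_poly horner_comp rmorphN /= map_polyX !hornerE.
rewrite -(divpK X_dvd) rmorphM rmorphN /= map_polyX !hornerE opprK.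
by rewrite mulf_eq0 (negPf y0) orbF.
Qed.

End Frobenius.

Theorem proposition2p4 (F : finFieldType) (K : closedFieldType)
    (iota : {rmorphism F -> K}) (algK : integralRange iota)
    (g : {poly F}) :
  good iota g -> ~ decomposable g.
Proof.
move=> [_ g0 g'0 [x orbx]] [g1 [g2 [_ _ sg1 sg2 gE]]].
rewrite !ltn_predRL in sg1 sg2.
set c := g2.[0].
have g1c : g1.[c] = 0 by rewrite -g0 gE horner_comp.
(* By the chain rule, [c] is a simple root of [g1] and [0] is a simple root of [g2 - c%:P]. *)
move: (g'0); rewrite gE deriv_comp hornerM horner_comp mulf_eq0 negb_or.
case/andP=> g1'c g2'0.
have [b bc g1b] : exists2 b, b != iota c & root (map_poly iota g1) b.
  apply: simple_root_not_unique.
  - by rewrite size_map_poly.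
  - by rewrite rootE horner_map fmorph_eq0 g1c.
  - by rewrite deriv_map horner_map fmorph_eq0.
have [a a0 g2a] : exists2 a, a != 0 & root (map_poly iota (g2 - c%:P)) a.
  apply: simple_root_not_unique.
  - rewrite size_map_poly size_polyDl // size_polyN.
    exact: leq_ltn_trans (size_polyC_leq1 c) (ltnW sg2).
  - by rewrite -(rmorph0 iota) rootE horner_map fmorph_eq0 !hornerE subrr.
  - rewrite deriv_map -(rmorph0 iota) horner_map (inj_eq (fmorph_inj iota)).
    by rewrite derivB derivC subr0.
have {}g2a : (map_poly iota g2).[a] = iota c.
  by move: g2a; rewrite rootE rmorphB /= map_polyC !hornerE subr_eq0 => /eqP.
have [d g2d] : exists d, (map_poly iota g2).[d] = b.
  have: size (map_poly iota g2 - b%:P) != 1.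
    rewrite size_polyDl size_map_poly; first by case: (size g2) sg2 => [|[]].
    rewrite size_polyN; exact: leq_ltn_trans (size_polyC_leq1 b) (ltnW sg2).
  case/closed_rootP=> d; rewrite rootE !hornerE subr_eq0 => /eqP; by exists d.
(* If [d] were [0], then [b] would be the image of [g2.[0] = c]. *)
have d0 : d != 0.
  apply: contraNneq bc => d0.
  by rewrite -g2d d0 -(rmorph0 iota) horner_map.
have gX z : (map_poly iota g).[z] = (map_poly iota g1).[(map_poly iota g2).[z]].
  by rewrite gE map_comp_poly horner_comp.
have orb z : z != 0 -> root (map_poly iota g) z -> in_frobenius_orbit #|F| x (- z).
  by move=> z0 gz; apply/orbx/root_reflected_quotient.
(* The orbit of [x] contains [- z] rather than [z], hence the composition with [- 'X]. The
   right-hand side does not depend on [z], so any two nonzero roots of [g] can be compared through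
   it. *)
have fib z : z != 0 -> root (map_poly iota g) z ->
    (map_poly iota g2).[z] = iota c <->
    (map_poly iota (g2 \Po - 'X)).[x] = iota c.
  move=> z0 gz.
  have := fibre_frobenius_orbit iota (g2 \Po - 'X) c (orb z z0 gz).
  by rewrite !map_comp_poly !horner_comp rmorphN /= map_polyX !hornerE opprK.
have ga : root (map_poly iota g) a.
  by rewrite rootE gX g2a horner_map g1c rmorph0.
have gd : root (map_poly iota g) d by rewrite rootE gX g2d -rootE.
(* The condition passes from [a] to [x] and then to [d], forcing [b = iota c]. *)
move: g2a => /(fib a a0 ga) /(fib d d0 gd).
by rewrite g2d => /eqP; apply/negP.
Qed.
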